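(* Let $K\in\{2,3,\dots\}$, let $\phi:[0,1]\to[-\infty,\infty]$ be a continuous strictly monotonic function that is integrable, i.e. $\int_0^1|\phi(u)|\,du<\infty$, with inverse $\psi$ (with domain $\phi([0,1])$), and let $\mathbf{w}=(w_1,\dots,w_K)\in\Delta_K$. Then for every $\epsilon\in(0,1]$ and all random variables $p_1,\dots,p_K$ on a common probability space, each uniformly distributed on $[0,1]$ (with arbitrary dependence), $$\mathbb{P}\left(M_{\phi,\mathbf{w}}(p_1,\dots,p_K)\le\psi\left(\frac1\epsilon\int_0^\epsilon\phi(u)\,du\right)\right)\le\epsilon .$$
   Context: $\Delta_K:=\{(w_1,\dots,w_K)\in[0,1]^K\mid w_1+\dots+w_K=1\}$. For $\phi,\psi,\mathbf{w}$ as in the claim, $M_{\phi,\mathbf{w}}(p_1,\dots,p_K):=\psi\left(w_1\phi(p_1)+\dots+w_K\phi(p_K)\right)$. (Infinite values of $\phi$ can occur only at the endpoints $0,1$, so for uniformly distributed $p_k$ the weighted sum is well defined and finite almost surely.) *)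

(* Defs.v *)
From HB Require Import structures.
From mathcomp Require Import all_boot all_order all_algebra.
From mathcomp Require Import all_classical all_reals all_analysis.

Set Implicit Arguments.
Unset Strict Implicit.
Unset Printing Implicit Defensive.
Import Order.TTheory GRing.Theory Num.Theory.
Import numFieldNormedType.Exports.
Local Open Scope classical_set_scope.
Local Open Scope ring_scope.

Definition simplex (R : realType) (K : nat) : set ('I_K -> R) :=
  [set w | (forall k, 0 <= w k <= 1) /\ \sum_(k < K) w k = 1].

(* A function on [0, 1] is represented by a total function on R that is only
   constrained on `[0, 1]. The orders on R and \bar R have different displays,
   hence the %R and %E below. *)
Definition strictly_monotonic01 (R : realType) (phi : R -> \bar R) : Prop :=
  {in `[0, 1] &, forall x y, (x < y)%R -> (phi x < phi y)%E} \/
  {in `[0, 1] &, forall x y, (x < y)%R -> (phi y < phi x)%E}.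

(* The inverse of phi restricted to [0, 1]: psi is determined on the image
   phi @` `[0, 1] and unconstrained elsewhere. *)
Definition inverse01 (R : realType) (phi : R -> \bar R) (psi : \bar R -> R)
    : Prop :=
  {in `[0, 1], cancel phi psi}.

(* Meaningful for u in [0, 1]^K. In \bar R, 0 * +oo = 0 * -oo = 0 and
   +oo + -oo = -oo; the second convention only matters when some coordinates
   of u equal 0 and others equal 1, and then -oo belongs to the image of phi. *)
Definition wmean (R : realType) (K : nat) (phi : R -> \bar R)
    (psi : \bar R -> R) (w u : 'I_K -> R) : R :=
  psi (\sum_(k < K) (w k)%:E * phi (u k))%E.

(* The law is compared on Borel sets only: the value of uniform_prob on a
   non-measurable set carries no information. *)
Definition uniform01 (R : realType) (d : measure_display)
    (T : measurableType d) (P : probability T R) (X : {RV P >-> R}) : Prop :=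
  forall A : set R, measurable A ->
    distribution P X A = uniform_prob (@ltr01 R) A.

(* Main.v *)
Require Import Defs.
From HB Require Import structures.
From mathcomp Require Import all_boot all_order all_algebra.
From mathcomp Require Import all_classical all_reals all_analysis.
From mathcomp Require Import measurable_realfun lra.
Set Implicit Arguments.
Unset Strict Implicit.
Unset Printing Implicit Defensive.
Import Order.TTheory GRing.Theory Num.Theory.
Import numFieldNormedType.Exports.
Local Open Scope classical_set_scope.
Local Open Scope ring_scope.

(** The statement reduces to a single application of Markov's inequality.

    Suppose first that phi is increasing, and let m be its average over
    [0, eps]. Every weighted mean of values of phi, and m itself, lies in the
    interval phi([0, 1]) ([wsum_image], [average_image], both from the
    intermediate value theorem in the extended reals, [ereal_IVT]), so
    applying psi on both sides is harmless: the event is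
    sum_k w_k phi(p_k) <= m.

    If eps = 1 there is nothing to prove. If eps < 1, the number c = phi(eps)
    is finite, and c > m because phi is strictly increasing ([average_lt]). Let
    g = max(c - phi, 0) be the shortfall of phi below c. On the event,
      sum_k w_k g(p_k) >= c - sum_k w_k phi(p_k) >= c - m > 0
    ([wsum_shortfall]). The left-hand side is a nonnegative random variable
    whose expectation is the integral of g over [0, 1], whatever the dependence
    between the p_k, because the weights sum to 1 and each p_k is uniform.
    Since g vanishes beyond eps, this integral is eps * (c - m)
    ([integral_shortfall]). Markov's inequality ([wsum_markov]) gives
    (c - m) * P(event) <= eps * (c - m), hence the bound
    ([prob_wsum_le_average]). The constant c is chosen so that the cut-off of g
    sits at eps: this is what makes the bound exactly eps.

    If phi is decreasing, the event is sum_k w_k phi(p_k) >= m, and the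
    previous case applies to -phi. Only one inclusion of events is needed, so
    the asymmetric convention +oo - oo = -oo, for which the opposite of a sum
    may differ from the sum of the opposites, does no harm ([wsumN_le]). *)

(** * Weighted means in the extended reals *)

(** Strict only when the family contains both +oo and -oo: then both sums
    equal -oo, and the right-hand side is +oo. *)
Lemma sumeN_le (R : realDomainType) (I : Type) (s : seq I) (x : I -> \bar R) :
  (\sum_(i <- s) - x i <= - \sum_(i <- s) x i)%E.
Proof.
elim: s => [|i s ih]; first by rewrite !big_nil oppe0.
rewrite !big_cons; apply: (le_trans (leeD2l _ ih)).
by case: (x i) => [a| |]; case: (\sum_(j <- s) x j)%E => [b| |] //=;
  rewrite lee_fin opprD.
Qed.

Lemma wsum_le (R : realType) (K : nat) (w : 'I_K -> R) (x y : 'I_K -> \bar R) :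
  simplex w -> (forall k, x k <= y k)%E ->
  (\sum_(k < K) (w k)%:E * x k <= \sum_(k < K) (w k)%:E * y k)%E.
Proof.
move=> [w01 _] xy; apply: lee_sum => k _; apply: lee_wpmul2l; last exact: xy.
by rewrite lee_fin; case/andP: (w01 k).
Qed.

Lemma wsum_cst (R : realType) (K : nat) (w : 'I_K -> R) (c : \bar R) :
  simplex w -> (\sum_(k < K) (w k)%:E * c = c)%E.
Proof.
move=> [w01 w1]; rewrite -ge0_sume_distrl; last first.
  by move=> k _; rewrite lee_fin; case/andP: (w01 k).
by rewrite sumEFin w1 mul1e.
Qed.

Lemma wsumN_le (R : realType) (K : nat) (w : 'I_K -> R) (x : 'I_K -> \bar R) :
  (\sum_(k < K) (w k)%:E * - x k <= - \sum_(k < K) (w k)%:E * x k)%E.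
Proof. by under eq_bigr do rewrite muleN; exact: sumeN_le. Qed.

(** Termwise, x k >= c - max (c - x k, 0). The total shortfall splits off from
    the sum because the shortfalls are all nonnegative, so that no indeterminate
    form occurs even if some x k is -oo. *)
Lemma wsum_shortfall (R : realType) (K : nat) (w : 'I_K -> R)
    (x : 'I_K -> \bar R) (c : R) : simplex w ->
  (c%:E - \sum_(k < K) (w k)%:E * maxe (c%:E - x k) 0
   <= \sum_(k < K) (w k)%:E * x k)%E.
Proof.
move=> hw; have w0 k : (0 <= (w k)%:E)%E.
  by rewrite lee_fin; case: hw => /(_ k) /andP[].
rewrite -[X in (X - _)%E](wsum_cst c%:E hw) -sumeN; last first.
  by move=> i j _ _; apply: ge0_adde_def; rewrite inE mule_ge0// le_max lexx orbT.
rewrite -big_split /=; apply: lee_sum => k _.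
rewrite -muleN -muleDr ?fin_num_adde_defr// lee_wpmul2l// oppe_max oppe0.
case: (x k) => [r| |] /=; last by rewrite minNye.
- by rewrite -EFin_min -EFinD lee_fin opprB -lerBrDl ge_min lexx.
- by rewrite leey.
Qed.

(** * The intermediate value theorem for extended real functions *)

(** By definition, the metric on the extended reals is the pullback of the usual
    one by contract. *)
Lemma continuous_contract (R : realType) : continuous (@contract R).
Proof.
move=> x; apply/cvgrPdist_lt => e e0.
exact: (@nbhsx_ballx R (\bar R) x e e0).
Qed.

(** The order embedding contract reduces the claim to a real-valued continuous
    function, whose image of a segment is connected, hence an interval. *)
Lemma ereal_IVT (R : realType) (f : R -> \bar R) (a b x y : R) (v : \bar R) :
  {within `[a, b], continuous f} ->
  x \in `[a, b] -> y \in `[a, b] -> (f x <= v <= f y)%E ->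
  exists2 z, z \in `[a, b] & f z = v.
Proof.
move=> fc xab yab /andP[xv vy].
have gc : {within `[a, b], continuous (@contract R \o f)}.
  move=> z; apply: (@continuous_comp (subspace `[a, b]) _ _ f (@contract R)).
    exact: (fc z).
  exact: continuous_contract.
have /connected_intervalP ci :=
  connected_continuous_connected (@segment_connected R a b) gc.
have im t : t \in `[a, b] -> [set (@contract R \o f) u | u in `[a, b]] (contract (f t)).
  by move=> tab; exists t.
have [|z zab fz] := ci _ _ (im x xab) (im y yab) (contract v).
  by rewrite !le_contract xv vy.
by exists z => //; exact: contract_inj fz.
Qed.

(** * Averages over an initial segment and the shortfall integral *)

Section average.
Context (R : realType).
Let mu := @lebesgue_measure R.
Implicit Types (f : R -> \bar R) (c e : R).

(** Written exactly as in the theorem, so that the two are convertible. *)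
Definition average f e : \bar R := (e^-1%:E * \int[mu]_(u in `[0%R, e]) f u)%E.

Lemma mule_average f e : 0 < e ->
  (e%:E * average f e = \int[mu]_(u in `[0%R, e]) f u)%E.
Proof. by move=> e0; rewrite muleA -EFinM mulfV ?gt_eqF// mul1e. Qed.

Lemma mu_segment e : 0 <= e -> mu `[0, e]%classic = e%:E.
Proof.
move=> e0; rewrite /mu lebesgue_measure_itv /= lte_fin.
case: ltP; first by rewrite oppr0 adde0.
by move=> ?; congr EFin; apply/eqP; rewrite eq_le e0.
Qed.

Lemma integral_cst_segment c e : 0 <= e ->
  (\int[mu]_(u in `[0%R, e]) c%:E = (c * e)%:E)%E.
Proof.
by move=> e0; rewrite integral_cst//= -/mu mu_segment.
Qed.

Lemma integrable_cst_segment c e : mu.-integrable `[0, e] (cst c%:E).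
Proof.
apply: (@continuous_compact_integrable R (cst c)); first exact: segment_compact.
by apply: continuous_subspaceT => x; exact: cvg_cst.
Qed.

Lemma integrable_initial f e : e <= 1 ->
  mu.-integrable `[0, 1] f -> mu.-integrable `[0, e] f.
Proof.
move=> e1; apply: integrableS => // u /=; rewrite !in_itv /=.
by move=> /andP[-> /le_trans->].
Qed.

Lemma measurable_shortfall f c : mu.-integrable `[0, 1] f ->
  measurable_fun (`[0, 1]%classic : set R) (fun u => maxe (c%:E - f u) 0)%E.
Proof.
move=> fi; apply: measurable_maxe => //; apply: emeasurable_funB => //.
exact: measurable_int fi.
Qed.

Section integrable.
Variables (f : R -> \bar R) (e : R).
Hypothesis e0 : 0 < e.
Hypothesis fe : mu.-integrable `[0, e] f.

Lemma average_fin : average f e \is a fin_num.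
Proof. by rewrite fin_numM// integrable_fin_num. Qed.

(** The bound c is an extended real because it will be an endpoint value of phi,
    which may be infinite. *)
Lemma average_ge (c : \bar R) : (c != +oo)%E ->
  {in `[0, e], forall u, (c <= f u)%E} -> (c <= average f e)%E.
Proof.
case: c => [c _ cf| //|_ _]; last exact: leNye.
rewrite lee_pdivlMl// -EFinM mulrC -integral_cst_segment; last exact: ltW.
apply: le_integral => //; first exact: integrable_cst_segment.
by move=> u; rewrite inE => /cf.
Qed.

Lemma averageN : average (fun u => - f u)%E e = (- average f e)%E.
Proof.
rewrite /average integralN ?muleN//; exact: integrable_add_def.
Qed.

End integrable.

Lemma average_le f e (c : \bar R) : 0 < e -> mu.-integrable `[0, e] f ->
  (c != -oo)%E -> {in `[0, e], forall u, (f u <= c)%E} -> (average f e <= c)%E.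
Proof.
move=> e0 fe cNy fc; rewrite -leeN2 -averageN//; apply: average_ge => //.
- exact: integrableN.
- by case: c cNy {fc}.
- by move=> u ue; rewrite leeN2 fc.
Qed.

(** The shortfall below c vanishes beyond e, and equals c - f before e. *)
Lemma integral_shortfall f c e : 0 < e -> e <= 1 ->
  mu.-integrable `[0, 1] f ->
  {in `[0, e], forall u, (f u <= c%:E)%E} ->
  {in `]e, 1], forall u, (c%:E <= f u)%E} ->
  (\int[mu]_(u in `[0%R, 1%R]) maxe (c%:E - f u) 0
   = e%:E * (c%:E - average f e))%E.
Proof.
move=> e0 e1 fi fle fge.
have mg := measurable_shortfall c fi.
have fe := integrable_initial e1 fi.
have U : `[0, 1]%classic = `[0, e]%classic `|` `]e, 1]%classic :> set R.
  by rewrite -itv_bndbnd_setU// bnd_simp// ltW.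
rewrite U ge0_integral_setU//=; first last.
- apply/disj_setPRL => u /=; rewrite !in_itv /= => /andP[eu _] /andP[_].
  by rewrite leNgt eu.
- by move=> u _; rewrite le_max lexx orbT.
- by rewrite -U.
rewrite [X in (_ + X)%E]integral0_eq ?adde0; last first.
  move=> u /fge cf; by apply/max_idPr; rewrite sube_le0.
transitivity (\int[mu]_(u in `[0%R, e]) (c%:E - f u))%E.
  apply: eq_integral => u; rewrite inE => /fle fc; apply/max_idPl.
  by rewrite sube_ge0 ?fin_numE ?orbT//.
rewrite (@integralB _ _ _ mu _ _ (cst c%:E))//; last exact: integrable_cst_segment.
rewrite integral_cst_segment ?ltW// muleBr ?fin_num_adde_defr//.
by rewrite mule_average// -EFinM mulrC.
Qed.

End average.

Section strictly_increasing.
Context (R : realType).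
Let mu := @lebesgue_measure R.
Variable f : R -> \bar R.
Hypothesis f_inc : {in `[0, 1] &, forall x y, (x < y)%R -> (f x < f y)%E}.
Hypothesis f_int : mu.-integrable `[0, 1] f.

Lemma inc_le01 : {in `[0, 1] &, forall x y, (f x <= f y)%E = (x <= y)}.
Proof.
move=> x y x01 y01; case: (ltgtP x y) => [xy|xy|->]; last exact: lexx.
- by rewrite ltW// f_inc.
- by apply/negbTE; rewrite -ltNge f_inc.
Qed.

(** If f e = c, the shortfall of f below c is at least c - f (e / 2) > 0 on
    [0, e / 2], so its integral e * (c - average f e) is positive. *)
Lemma average_lt e : 0 < e -> e < 1 -> (average f e < f e)%E.
Proof.
move=> e0 e1.
have i0 : (0 : R) \in `[0, 1] by rewrite in_itv /= lexx ler01.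
have i1 : (1 : R) \in `[0, 1] by rewrite in_itv /= lexx ler01.
have ie : e \in `[0, 1] by rewrite in_itv /= !ltW.
(* Any point strictly between 0 and e would do. *)
pose h := e / 2.
have [h0 he] : 0 < h /\ h < e by rewrite /h; split; lra.
have ih : h \in `[0, 1] by rewrite in_itv /= !ltW// (lt_trans he).
have fin x : 0 < x -> x < 1 -> f x \is a fin_num.
  move=> x0 x1; have ix : x \in `[0, 1] by rewrite in_itv /= !ltW.
  rewrite fin_numElt (le_lt_trans (leNye _) (f_inc i0 ix x0)).
  by rewrite (lt_le_trans (f_inc ix i1 x1) (leey _)).
have := fin e e0 e1; have := fin h h0 (lt_trans he e1).
have := f_inc ih ie he.
move fhE : (f h) => [b| |] //; move feE : (f e) => [c| |] // bc _ _.
rewrite lte_fin in bc.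
have le01 := inc_le01.
have sf := @integral_shortfall R f c e e0 (ltW e1) f_int.
have : (0 < e%:E * (c%:E - average f e))%E.
  rewrite -sf; first last.
  - move=> u; rewrite in_itv /= => /andP[eu u1].
    by rewrite -feE ltW// f_inc// in_itv /= u1 andbT ltW// (lt_trans e0).
  - move=> u; rewrite in_itv /= => /andP[u0 ue].
    by rewrite -feE le01// in_itv /= u0 (le_trans ue)// ltW.
  apply: (@lt_le_trans _ _ ((c - b) * h)%:E).
    by rewrite lte_fin mulr_gt0// subr_gt0.
  rewrite -integral_cst_segment; last exact: ltW.
  have sub : `[0, h]%classic `<=` (`[0, 1]%classic : set R).
    move=> u /=; rewrite !in_itv /= => /andP[-> uh].
    by rewrite (le_trans uh)// ltW// (lt_trans he).
  have mg := measurable_shortfall c f_int.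
  apply: (@le_trans _ _
      (\int[mu]_(u in `[0%R, h]) maxe (c%:E - f u) 0)%E); last first.
    apply: ge0_subset_integral => //.
    by move=> u _; rewrite le_max lexx orbT.
  apply: ge0_le_integral => //.
  - by move=> u _; rewrite lee_fin subr_ge0 ltW.
  - exact: (measurable_funS _ sub mg).
  - move=> u uh; rewrite le_max; apply/orP; left.
    rewrite EFinB leeB// -fhE le01//; last exact: sub.
    by move: uh; rewrite /= in_itv /= => /andP[].
by rewrite pmule_rgt0 ?lte_fin// sube_gt0.
Qed.

End strictly_increasing.

(** * Markov's inequality for weighted means of uniform variables *)

(** The law of X and uniform_prob live on two instances of the Borel sigma
    algebra that are convertible but distinct: viewing X as a map Y into the one
    that carries the Lebesgue measure aligns them. *)
Lemma uniform01_integral (R : realType) (d : measure_display)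
    (T : measurableType d) (P : probability T R) (X : {RV P >-> R})
    (g : R -> \bar R) :
  uniform01 X -> measurable_fun setT g -> (forall u, 0 <= g u)%E ->
  (\int[P]_t g (X t) = \int[@lebesgue_measure R]_(u in `[0%R, 1%R]) g u)%E.
Proof.
move=> Xu mg g0.
pose Y : T -> measurableTypeR R := X.
have mY : measurable_fun setT Y := @measurable_funP _ _ _ _ setT X.
have mg' : @measurable_fun _ _ (measurableTypeR R) _ setT g := mg.
have := ge0_integral_pushforward mY P measurableT mg' (fun u _ => g0 u).
rewrite preimage_setT => <-.
rewrite (eq_measure_integral (uniform_prob (@ltr01 R))); last first.
  by move=> A mA _; exact: Xu.
by rewrite integral_uniform// subr0 invr1 mul1e.
Qed.

Lemma measurable_all01 (R : realType) (d : measure_display)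
    (T : measurableType d) (K : nat) (p : 'I_K -> T -> R) :
  (forall k, measurable_fun setT (p k)) ->
  measurable [set t | forall k, 0 <= p k t <= 1].
Proof.
move=> mp.
rewrite (_ : [set t | _] = \bigcap_(k in [set: 'I_K]) (p k @^-1` `[0, 1]%classic)).
  apply: fin_bigcap_measurable => // k _.
  by rewrite -[X in measurable X]setTI; apply: mp.
by apply/seteqP; split=> t /=; [move=> h k _ /=; rewrite in_itv /= h
  |move=> h k; have := h k I; rewrite /= in_itv].
Qed.

Lemma measurable_wsum (R : realType) (d : measure_display)
    (T : measurableType d) (K : nat) (p : 'I_K -> T -> R) (w : 'I_K -> R)
    (f : R -> \bar R) :
  (forall k, measurable_fun setT (p k)) -> measurable_fun (`[0, 1]%classic : set R) f ->
  measurable_fun [set t | forall k, 0 <= p k t <= 1]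
    (fun t => \sum_(k < K) (w k)%:E * f (p k t))%E.
Proof.
move=> mp mf; apply: emeasurable_sum => k; apply: measurable_funeM.
apply: (@measurable_comp _ _ _ T R (\bar R) `[0%R, 1%R]%classic f _ (p k)) => //.
- by move=> _ [t /= h <-]; rewrite /= in_itv /= h.
- exact: measurable_funTS.
Qed.

(** The expectation of the weighted sum of the g (p k) is computed by linearity,
    so the joint law of the p k never matters. The function g is first cut off
    outside [0, 1], because the p k may leave [0, 1] on a null set. *)
Lemma wsum_markov (R : realType) (d : measure_display)
    (T : measurableType d) (P : probability T R) (K : nat)
    (p : 'I_K -> {RV P >-> R}) (w : 'I_K -> R) (g : R -> \bar R) (a : R) :
  (forall k, uniform01 (p k)) -> simplex w -> measurable_fun (`[0, 1]%classic : set R) g ->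
  (forall u, 0 <= g u)%E -> (0 < a) ->
  (a%:E * P [set t | (forall k, 0 <= p k t <= 1)%R /\
                     (a%:E <= \sum_(k < K) (w k)%:E * g (p k t))%E]
   <= \int[@lebesgue_measure R]_(u in `[0%R, 1%R]) g u)%E.
Proof.
move=> pu hw mg g0 a0; have w0 k : (0 <= (w k)%:E)%E.
  by rewrite lee_fin; case: hw => /(_ k) /andP[].
set D := [set t | forall k, 0 <= p k t <= 1].
set h := (g \_ `[0, 1]).
have h0 u : (0 <= h u)%E by exact: erestrict_ge0.
have mh : measurable_fun setT h by apply/(measurable_restrictT _ _).1.
have mhp k : measurable_fun setT (fun t => h (p k t)).
  by apply: measurableT_comp => //; exact: measurable_funP.
set S := (fun t => \sum_(k < K) (w k)%:E * h (p k t))%E.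
have S0 t : (0 <= S t)%E by apply: sume_ge0 => k _; exact: mule_ge0.
have mS : measurable_fun setT S.
  by apply: emeasurable_sum => k; apply: measurable_funeM.
have mD : measurable D by apply: measurable_all01 => k; exact: measurable_funP.
have mE : measurable [set t | a%:E <= S t]%E.
  by rewrite -[X in measurable X]setTI; exact: emeasurable_fun_c_infty.
have -> : (\int[@lebesgue_measure R]_(u in `[0%R, 1%R]) g u = \int[P]_t S t)%E.
  rewrite ge0_integral_sum//; last 2 first.
  - by move=> k; exact: measurable_funeM.
  - by move=> k t _; exact: mule_ge0.
  under eq_bigr => k _.
    rewrite ge0_integralZl//.
    rewrite (uniform01_integral (pu k) mh h0) /h.
    over.
  rewrite wsum_cst//.
  by apply: eq_integral => u u01; rewrite patchE u01.
have := @le_integral_comp_abse _ _ _ P _ measurableT S a id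
   (@measurable_id _ _ setT) (fun _ => id) (fun _ _ _ _ => id) mS a0.
under eq_integral do rewrite gee0_abs//.
apply: le_trans; apply: lee_wpmul2l; first by rewrite lee_fin ltW.
rewrite setTI; under [X in (_ <= P X)%E]eq_set do rewrite gee0_abs//.
apply: le_measure; rewrite ?inE//.
  by apply: emeasurable_fun_c_infty => //; exact: measurable_wsum.
move=> t [Dt]; congr (_ <= _)%E; apply: eq_bigr => k _.
by rewrite /h patchE mem_set//= in_itv/= Dt.
Qed.

(** Markov's inequality for the shortfall of f below c = f e. The value f e is
    finite only for e < 1; for e = 1 the bound is trivial. *)
Lemma prob_wsum_le_average (R : realType) (d : measure_display)
    (T : measurableType d) (P : probability T R) (K : nat)
    (p : 'I_K -> {RV P >-> R}) (w : 'I_K -> R) (f : R -> \bar R) (e : R) :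
  (forall k, uniform01 (p k)) -> simplex w ->
  {in `[0, 1] &, forall x y, (x < y)%R -> (f x < f y)%E} ->
  (@lebesgue_measure R).-integrable `[0, 1] f ->
  0 < e -> e <= 1 ->
  (P [set t | (forall k, 0 <= p k t <= 1)%R /\
              (\sum_(k < K) (w k)%:E * f (p k t) <= average f e)%E] <= e%:E)%E.
Proof.
move=> pu hw f_inc f_int e0 e1.
have mf := measurable_int _ f_int.
have mp k : measurable_fun setT (p k) := @measurable_funP _ _ _ _ setT (p k).
have mD := measurable_all01 mp.
have mE a : measurable ([set t | (forall k, 0 <= p k t <= 1)%R /\
              (\sum_(k < K) (w k)%:E * f (p k t) <= a)%E]).
  by apply: emeasurable_fun_infty_c => //; exact: measurable_wsum.
move: e1; rewrite le_eqVlt => /predU1P[->|e1]; first exact: probability_le1.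
have fe := integrable_initial (ltW e1) f_int.
have i1 : (1 : R) \in `[0, 1] by rewrite in_itv /= lexx ler01.
have ie : e \in `[0, 1] by rewrite in_itv /= !ltW.
have le01 := inc_le01 f_inc.
have := average_lt f_inc f_int e0 e1.
have : (f e < +oo)%E by exact: lt_le_trans (f_inc _ _ ie i1 e1) (leey _).
have sf := @integral_shortfall R f _ e e0 (ltW e1) f_int.
have := average_fin fe; move avgE : (average f e) => [b| |] // _.
move feE : (f e) => [c| |] // _; rewrite lte_fin => bc.
have cb : 0 < c - b by rewrite subr_gt0.
rewrite -(@lee_pmul2l _ (c - b)%:E) ?lte_fin// muleC [leRHS]muleC.
have mg := measurable_shortfall c f_int.
have g0 u : (0 <= maxe (c%:E - f u) 0)%E by rewrite le_max lexx orbT.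
have := wsum_markov pu hw mg g0 cb.
rewrite sf; first last.
- move=> u; rewrite in_itv /= => /andP[eu u1].
  by rewrite -feE ltW// f_inc// in_itv /= u1 andbT ltW// (lt_trans e0).
- move=> u; rewrite in_itv /= => /andP[u0 ue].
  by rewrite -feE le01// in_itv /= u0 (le_trans ue)// ltW.
rewrite avgE [leLHS]muleC; apply: le_trans.
rewrite lee_wpmul2r ?lee_fin ?(ltW cb)//.
apply: le_measure; rewrite ?inE//.
  by apply: emeasurable_fun_c_infty => //; exact: measurable_wsum mp mg.
(* The average b of f is finite, so c - S <= b gives c - b <= S, for every value
   of the total shortfall S in the extended reals. *)
move=> t [pt st]; split=> //.
have := le_trans (wsum_shortfall (fun k => f (p k t)) c hw) st.
case: (\sum_(k < K) _)%E => [r| |] /=; rewrite ?leey// -?EFinB ?lee_fin//.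
by rewrite lerBlDl lerBlDr.
Qed.

(** * Membership in the range of phi *)

Lemma dec_le01 (R : realType) (f : R -> \bar R) :
  {in `[0, 1] &, forall x y, (x < y)%R -> (f y < f x)%E} ->
  {in `[0, 1] &, forall x y, (f x <= f y)%E = (y <= x)}.
Proof.
move=> f_dec x y x01 y01; case: (ltgtP y x) => [xy|xy|->]; last exact: lexx.
- by rewrite ltW// f_dec.
- by apply/negbTE; rewrite -ltNge f_dec.
Qed.

(** The endpoints in the order in which phi takes its extreme values: this
    treats the increasing and the decreasing case together. *)
Lemma monotonic_bounds (R : realType) (phi : R -> \bar R) :
  strictly_monotonic01 phi ->
  exists a b, [/\ a \in `[0, 1], b \in `[0, 1], (phi a < phi b)%E &
    {in `[0, 1], forall u, (phi a <= phi u <= phi b)%E}].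
Proof.
have i0 : (0 : R) \in `[0, 1] by rewrite in_itv /= lexx ler01.
have i1 : (1 : R) \in `[0, 1] by rewrite in_itv /= lexx ler01.
case=> [inc|dec]; [exists 0, 1|exists 1, 0]; split=> //.
- exact: inc.
- by move=> u u01; rewrite !(inc_le01 inc).
- exact: dec.
- by move=> u u01; rewrite !(dec_le01 dec)// andbC.
Qed.

Lemma average_image (R : realType) (phi : R -> \bar R) (e : R) :
  {within `[0, 1], continuous phi} -> strictly_monotonic01 phi ->
  (@lebesgue_measure R).-integrable `[0, 1] phi -> 0 < e -> e <= 1 ->
  exists2 y, y \in `[0, 1] & phi y = average phi e.
Proof.
move=> cphi /monotonic_bounds[a [b [a01 b01 ab phiab]]] iphi e0 e1.
have sub u : u \in `[0, e] -> u \in `[0, 1].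
  by rewrite !in_itv /= => /andP[-> /le_trans->].
have ie := integrable_initial e1 iphi.
apply: (ereal_IVT cphi a01 b01); rewrite average_ge ?average_le//.
- by rewrite gt_eqF// (le_lt_trans (leNye _) ab).
- by move=> u /sub /phiab /andP[].
- by rewrite lt_eqF// (lt_le_trans ab (leey _)).
- by move=> u /sub /phiab /andP[].
Qed.

Lemma wsum_image (R : realType) (phi : R -> \bar R) (K : nat)
    (w u : 'I_K -> R) :
  {within `[0, 1], continuous phi} -> strictly_monotonic01 phi ->
  simplex w -> (forall k, u k \in `[0, 1]) ->
  exists2 z, z \in `[0, 1] & phi z = (\sum_(k < K) (w k)%:E * phi (u k))%E.
Proof.
move=> cphi /monotonic_bounds[a [b [a01 b01 _ phiab]]] hw u01.
apply: (ereal_IVT cphi a01 b01).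
rewrite -(wsum_cst (phi a) hw) -[X in (_ <= _ <= X)%E](wsum_cst (phi b) hw).
by rewrite !wsum_le// => k; case/andP: (phiab _ (u01 k)).
Qed.

(** * The weighted mean of uniform variables *)

Theorem mainTheorem9 (R : realType) (K : nat) (hK : (2 <= K)%N)
    (phi : R -> \bar R) (psi : \bar R -> R)
    (phi_cont : {within `[0, 1], continuous phi})
    (phi_mono : strictly_monotonic01 phi)
    (phi_int : (@lebesgue_measure R).-integrable `[0, 1] phi)
    (psi_inv : inverse01 phi psi)
    (w : 'I_K -> R) (hw : simplex w)
    (eps : R) (eps_gt0 : 0 < eps) (eps_le1 : eps <= 1)
    (d : measure_display) (T : measurableType d) (P : probability T R)
    (p : 'I_K -> {RV P >-> R}) (p_unif : forall k, uniform01 (p k)) :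
  let avg := (eps^-1%:E *
    \int[@lebesgue_measure R]_(u in `[0%R, eps]) phi u)%E in
  (P [set t | (forall k, 0 <= p k t <= 1) /\
              wmean phi psi w (fun k => p k t) <= psi avg]%R
   <= eps%:E)%E.
Proof.
cbv zeta; rewrite -/(average phi eps).
have [y y01 phiy] := average_image phi_cont phi_mono phi_int eps_gt0 eps_le1.
have -> : psi (average phi eps) = y by rewrite -phiy psi_inv.
set s := fun t => (\sum_(k < K) (w k)%:E * phi (p k t))%E.
have im t : (forall k, 0 <= p k t <= 1)%R ->
    exists2 z, z \in `[0, 1] & phi z = s t.
  by move=> pt; apply: wsum_image => // k; rewrite in_itv /= pt.
have mf := measurable_int _ phi_int.
have mp k : measurable_fun setT (p k) := @measurable_funP _ _ _ _ setT (p k).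
have mD := measurable_all01 mp.
have ms := measurable_wsum w mp mf.
case: (phi_mono) => [inc|dec].
  rewrite (_ : [set t | _] =
      [set t | (forall k, 0 <= p k t <= 1)%R /\ (s t <= average phi eps)%E]).
    exact: prob_wsum_le_average.
  apply/seteqP; split=> t [pt]; have [z z01 zs] := im t pt;
    by rewrite /wmean /= -/(s t) -phiy -zs psi_inv// inc_le01.
rewrite (_ : [set t | _] =
    [set t | (forall k, 0 <= p k t <= 1)%R /\ (average phi eps <= s t)%E]); last first.
  apply/seteqP; split=> t [pt]; have [z z01 zs] := im t pt;
    by rewrite /wmean /= -/(s t) -phiy -zs psi_inv// dec_le01.
have phiNi : (@lebesgue_measure R).-integrable `[0, 1] (fun u => - phi u)%E.
  exact: integrableN.
have Ninc : {in `[0, 1] &, forall x y, (x < y)%R -> (- phi x < - phi y)%E}.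
  by move=> a b a01 b01 ab; rewrite lteN2 dec.
(* The event may be strictly smaller than the one for -phi, so the comparison
   needs the measurability of both. *)
apply: le_trans (prob_wsum_le_average p_unif hw Ninc phiNi eps_gt0 eps_le1).
apply: le_measure; rewrite ?inE.
- exact: emeasurable_fun_c_infty.
- apply: emeasurable_fun_infty_c => //.
  exact: measurable_wsum mp (measurable_int _ phiNi).
move=> t [pt st]; split=> //; apply: (le_trans (wsumN_le _ _)).
rewrite averageN ?leeN2//.
exact: integrable_initial phi_int.
Qed.
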